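(* Let $G$ be a locally compact amenable group which acts on a sclocc median algebra $M$ by continuous automorphisms. Then $M$ contains a $G$-invariant cube; that is, there is a cube $Q\subset M$ with $gQ=Q$ for every $g\in G$.
   Context: A median algebra is a set $M$ with a ternary operation $m:M^3\to M$ (the median operator) such that for all $x,y,z,u,v\in M$: (1) $m(x,y,z)=m(x,z,y)=m(y,x,z)$; (2) $m(x,x,y)=x$; (3) $m(m(x,y,z),u,v)=m(x,m(y,u,v),m(z,u,v))$. A median morphism is a map $\varphi$ between median algebras with $\varphi(m(x,y,z))=m(\varphi(x),\varphi(y),\varphi(z))$; an automorphism of $M$ is a bijective median morphism from $M$ to itself. For $x,y\in M$ the interval is $[x,y]=\{u\in M: m(x,y,u)=u\}$; a subset $C\subset M$ is convex if $[x,y]\subset C$ for all $x,y\in C$. A topological median algebra is a median algebra with a Hausdorff topology for which $m$ is continuous. It is locally open-convex if every point has a basis of open and convex neighborhoods. It is sclocc if it is second countable, locally open-convex and compact. The set $\{0,1\}$ carries the standard (majority) median operation; $\{0,1\}^I$ carries the coordinate-wise median and the product topology. A cube in $M$ is a subset of the form $f(\{0,1\}^I)$ where $I$ is a countable (possibly finite or empty) set and $f:\{0,1\}^I\to M$ is an injective continuous median morphism. *)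

(* Defs.v *)
From HB Require Import structures.
From mathcomp Require Import all_boot all_order all_algebra.
From mathcomp Require Import all_classical all_reals all_analysis.

Set Implicit Arguments.
Unset Strict Implicit.
Unset Printing Implicit Defensive.

Import Order.TTheory GRing.Theory Num.Theory.
Import numFieldNormedType.Exports.

Local Open Scope classical_set_scope.
Local Open Scope ring_scope.

Definition is_median (T : Type) (m : T -> T -> T -> T) : Prop :=
  [/\ (forall x y z, m x y z = m x z y /\ m x y z = m y x z),
      (forall x y, m x x y = x) &
      (forall x y z u v, m (m x y z) u v = m x (m y u v) (m z u v))].

Definition median_morphism (T U : Type) (mT : T -> T -> T -> T)
    (mU : U -> U -> U -> U) (phi : T -> U) : Prop :=
  forall x y z, phi (mT x y z) = mU (phi x) (phi y) (phi z).

Definition median_automorphism (T : Type) (m : T -> T -> T -> T)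
    (phi : T -> T) : Prop :=
  bijective phi /\ median_morphism m m phi.

Definition median_interval (T : Type) (m : T -> T -> T -> T) (x y : T) :
    set T :=
  [set u | m x y u = u].

Definition median_convex (T : Type) (m : T -> T -> T -> T) (C : set T) : Prop :=
  forall x y, C x -> C y -> median_interval m x y `<=` C.

Definition topological_median (M : topologicalType) (m : M -> M -> M -> M) :
    Prop :=
  [/\ is_median m, hausdorff_space M &
      continuous (fun p : M * M * M => m p.1.1 p.1.2 p.2)].

Definition locally_open_convex (M : topologicalType) (m : M -> M -> M -> M) :
    Prop :=
  forall (x : M) (U : set M), nbhs x U ->
    exists V : set M, [/\ open_nbhs x V, median_convex m V & V `<=` U].

Definition sclocc (M : topologicalType) (m : M -> M -> M -> M) : Prop :=
  [/\ topological_median m, @second_countable M,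
      locally_open_convex m & compact [set: M]].

Definition maj (a b c : bool) : bool := [|| a && b, b && c | c && a].

Definition cube_median (I : Type) (a b c : {ptws I -> bool}) :
    {ptws I -> bool} :=
  fun i => maj (a i) (b i) (c i).

Definition is_cube (M : topologicalType) (m : M -> M -> M -> M) (Q : set M) :
    Prop :=
  exists (I : Type) (f : {ptws I -> bool} -> M),
    [/\ countable [set: I], injective f, continuous f,
        median_morphism (@cube_median I) m f & Q = range f].

HB.mixin Record Group_isTopological (G : Type) & Group G & Topological G := {
  mulg_continuous_subproof : continuous (fun p : G * G => (p.1 * p.2)%g);
  invg_continuous_subproof : continuous (fun x : G => (x^-1)%g)
}.

#[short(type="topologicalGroupType")]
HB.structure Definition TopologicalGroup :=
  {G of Group G & Topological G & Group_isTopological G}.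

(* As usual, locally compact groups are assumed to be Hausdorff. *)
Definition locally_compact_group (G : topologicalGroupType) : Prop :=
  hausdorff_space G /\ locally_compact [set: G].

Definition bounded_continuous (R : realType) (G : topologicalType) :
    set (G -> R) :=
  [set f | continuous f /\ bounded_fun f].
Arguments bounded_continuous : clear implicits.

(* [mu] is a total function, but only its values on C_b(G) matter. *)
Definition left_invariant_mean (R : realType) (G : topologicalGroupType)
    (mu : (G -> R) -> R) : Prop :=
  let Cb := bounded_continuous R G in
  [/\ (forall (a : R) (f g : G -> R), Cb f -> Cb g ->
         mu (fun x => a * f x + g x) = a * mu f + mu g),
      (forall f : G -> R, Cb f -> (forall x, 0 <= f x) -> 0 <= mu f),
      mu (fun=> 1) = 1 &
      (forall (h : G) (f : G -> R), Cb f ->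
         mu (fun x => f (h^-1 * x)%g) = mu f)].

(* For a locally compact group, the existence of a left-invariant mean on
   C_b(G) is equivalent to the existence of one on L^oo(G, Haar). *)
Definition amenable (R : realType) (G : topologicalGroupType) : Prop :=
  exists mu : (G -> R) -> R, left_invariant_mean mu.

(* The action is only required to be separately continuous; when [G] is locally
   compact and [M] is compact Hausdorff, joint continuity follows by Ellis'
   theorem. Continuity in the group variable cannot be dropped, as otherwise the
   topology of [G] (hence its amenability) would be unrelated to the action. *)
Definition acts_by_continuous_automorphisms (G : topologicalGroupType)
    (M : topologicalType) (m : M -> M -> M -> M) (act : G -> M -> M) : Prop :=
  [/\ (forall x, act 1%g x = x),
      (forall g h x, act (g * h)%g x = act g (act h x)),
      (forall g, median_automorphism m (act g) /\ continuous (act g)) &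
      (forall x, continuous (fun g => act g x))].

(* Main.v *)
Require Import Defs.
From mathcomp Require Import all_boot all_order all_algebra.
From mathcomp Require Import all_classical all_reals all_analysis.
From mathcomp Require Import lra finmap.
From HB Require Import structures.

(** An invariant cube is found as a minimal invariant closed median
    subalgebra [N], which exists by Zorn's lemma and compactness
    ([minimal_subsystem_exists]).  Replacing [M] by [N], assume that [M] itself
    is minimal; the claim is then that all of [M] is a cube
    ([minimal_system_cube]).

    Averaging functions over an orbit by the invariant mean gives an invariant
    state on C(M) ([orbit_state]), the functional form of an invariant
    probability measure.  Call a closed set heavy if every nonnegative
    continuous function that is at least 1 on it has mean greater than 1/2.
    Two heavy sets meet, so by Helly's theorem and compactness all heavy closed
    convex sets have a common point; their intersection is closed, convex and
    invariant, hence equal to [M] ([heavy_full]).  So a proper closed convex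
    set is never heavy, and when two of them cover [M] each has mass at least
    1/2 ([cut_half]).

    The main step is [half_cover]: if [C] and [D] are disjoint closed convex
    sets of mass at least 1/2, then [C `|` D] carries the whole mass.  A union
    of two convex sets is a subalgebra, because among any three points two lie
    in the same set.  The points whose whole orbit stays in [C `|` D] thus form
    an invariant closed subalgebra, nonempty since it contains the support of
    the state, and minimality gives [C `|` D = M].

    This has two consequences.  Distinct points [p] and [q] are separated by a
    clopen half-space ([minimal_separated]): closures of complementary
    half-spaces give a closed convex cover of [M] that cuts [q] from [p], a
    second cut separates [q] from the side of [p], and the two outer sides are
    disjoint of mass at least 1/2.  And clopen half-spaces are never properly
    nested ([minimal_antichain]): if H is contained in K, then H and the
    complement of K cover [M].

    Choose a base point [o] and let [I] be the set of nonempty clopen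
    half-spaces that avoid [o].  Membership defines a continuous median
    morphism from [M] to {0,1}^I.  It is injective by separation.  It is
    surjective because, in the absence of nesting, any choice of sides meets
    pairwise, so that Helly's theorem applies ([cube_criterion]).  The index
    set is countable since a compact second countable space has only countably
    many clopen sets. *)

Set Implicit Arguments.
Unset Strict Implicit.
Unset Printing Implicit Defensive.

Import Order.TTheory GRing.Theory Num.Theory.
Import numFieldNormedType.Exports.

Local Open Scope classical_set_scope.

(** * Median algebras: intervals, Helly's theorem, separation by half-spaces *)

Definition halfspace (T : Type) (m : T -> T -> T -> T) (H : set T) : Prop :=
  median_convex m H /\ median_convex m (~` H).

Definition subalgebra (T : Type) (m : T -> T -> T -> T) (A : set T) : Prop :=
  forall x y z, A x -> A y -> A z -> A (m x y z).

Section MedianAlgebra.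
Context {T : Type} {m : T -> T -> T -> T}.
Context (med : is_median m).

Lemma med_swap x y z : m x y z = m x z y.
Proof. by case: med => /(_ x y z)[]. Qed.

Lemma med_swapl x y z : m x y z = m y x z.
Proof. by case: med => /(_ x y z)[]. Qed.

Lemma med_rot x y z : m x y z = m y z x.
Proof. by rewrite med_swapl med_swap. Qed.

Lemma med_xxy x y : m x x y = x.
Proof. by case: med. Qed.

Lemma med_xyx x y : m x y x = x.
Proof. by rewrite med_swap med_xxy. Qed.

Lemma med_yxx x y : m y x x = x.
Proof. by rewrite med_swapl med_xyx. Qed.

Lemma med_distr x y z u v : m (m x y z) u v = m x (m y u v) (m z u v).
Proof. by case: med. Qed.

Lemma itvE x y u : median_interval m x y u <-> m u x y = u.
Proof. by rewrite /median_interval /= -med_rot. Qed.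

Lemma itv_l x y : median_interval m x y x.
Proof. exact: med_xyx. Qed.

Lemma itv_r x y : median_interval m x y y.
Proof. exact: med_yxx. Qed.

Lemma itv_med x y z : median_interval m x y (m x y z).
Proof. by apply/itvE; rewrite -(med_rot z x y) med_distr med_xxy med_xyx. Qed.

Lemma itv_med_xz x y z : median_interval m x z (m x y z).
Proof. by rewrite med_swap; exact: itv_med. Qed.

Lemma itv_convex x y : median_convex m (median_interval m x y).
Proof.
move=> u v /itvE xyu /itvE xyv w /itvE uvw; apply/itvE.
by rewrite -[in LHS]uvw med_distr xyu xyv.
Qed.

Lemma convexI (A B : set T) :
  median_convex m A -> median_convex m B -> median_convex m (A `&` B).
Proof.
move=> cA cB x y [Ax Bx] [Ay By] u uxy.
by split; [exact: (cA x y)|exact: (cB x y)].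
Qed.

Lemma convex_med (A : set T) x y z :
  median_convex m A -> A x -> A y -> A (m x y z).
Proof. by move=> cA Ax Ay; apply: (cA x y) => //; exact: itv_med. Qed.

(** Of three points, two lie in the same convex set, which contains the
    median of the three. *)
Lemma subalgebraU (A B : set T) :
  median_convex m A -> median_convex m B -> subalgebra m (A `|` B).
Proof.
move=> cA cB x y z.
have pA a b c : A a -> A b -> (A `|` B) (m a b c) by left; exact: convex_med.
have pB a b c : B a -> B b -> (A `|` B) (m a b c) by right; exact: convex_med.
move=> [Ax|Bx] [Ay|By] [Az|Bz]; first [exact: pA|exact: pB
  |by rewrite med_swap; first [exact: pA|exact: pB]
  |by rewrite med_rot; first [exact: pA|exact: pB]].
Qed.

(** The median of one point from each pairwise intersection is in all three
    sets. *)
Lemma helly3 (A B C : set T) :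
  median_convex m A -> median_convex m B -> median_convex m C ->
  A `&` B !=set0 -> B `&` C !=set0 -> A `&` C !=set0 ->
  A `&` B `&` C !=set0.
Proof.
move=> cA cB cC [a [Aa Ba]] [b [Bb Cb]] [c [Ac Cc]]; exists (m a b c).
split; first split; first 1 last.
- exact: convex_med.
- by rewrite med_rot; exact: convex_med.
- by rewrite med_swap; exact: convex_med.
Qed.

(** Helly's theorem for finitely many sets, with one of them, [A], singled out
    so that the induction can intersect [A] with the sets one by one; [helly3]
    keeps the pairwise intersections nonempty. *)
Lemma helly_seq (I : eqType) (s : seq I) (F : I -> set T) (A : set T) :
  median_convex m A -> A !=set0 ->
  (forall i, i \in s -> median_convex m (F i)) ->
  (forall i, i \in s -> A `&` F i !=set0) ->
  (forall i j, i \in s -> j \in s -> F i `&` F j !=set0) ->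
  exists x, A x /\ forall i, i \in s -> F i x.
Proof.
elim: s A => [|i s IH] A cA A0 cF AF FF; first by have [x Ax] := A0; exists x.
have is_ : i \in i :: s by rewrite inE eqxx.
have sub j : j \in s -> j \in i :: s by rewrite inE orbC => ->.
have [|||j js|j k js ks|x [[Ax Fx] Fsx]] := IH (A `&` F i).
- by apply: convexI => //; exact: cF.
- exact: AF.
- by move=> j /sub; exact: cF.
- have js' := sub _ js.
  by apply: helly3; [|exact: cF|exact: cF|exact: AF|exact: FF|exact: AF].
- by apply: FF; exact: sub.
by exists x; split=> // j; rewrite inE => /predU1P[->//|/Fsx].
Qed.

(** [m w x z] is the gate of [w] in the interval [[x, z]], hence lies between
    [w] and every point [u] of that interval. *)
Lemma itv_gate w x z u :
  median_interval m x z u -> median_interval m w u (m w x z).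
Proof.
move=> /itvE xzu; apply/itvE; set p := m w x z.
have wxp : m x w p = p by rewrite (med_swapl x); exact: itv_med.
have wzp : m z w p = p by rewrite (med_swapl z); exact: itv_med_xz.
have -> : m p w u = m u w p by rewrite med_swap med_rot med_swap.
by rewrite -[u in LHS]xzu med_distr wxp wzp med_yxx.
Qed.

(** Pasch's axiom.  The common point is [m x y z], which is the gate of [x] in
    [[y, z]] and the gate of [y] in [[x, z]]. *)
Lemma pasch x y z h k :
  median_interval m y z h -> median_interval m x z k ->
  median_interval m x h `&` median_interval m y k !=set0.
Proof.
move=> yzh xzk; exists (m x y z); split; first exact: itv_gate.
by rewrite med_swapl; exact: itv_gate.
Qed.

(** Distributivity moves the endpoints inwards one at a time: [w] is between [p]
    and [v], then between [p] and [q]. *)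
Lemma itv_trim u v w p q :
  median_interval m u v w -> median_interval m w u p ->
  median_interval m w v q -> median_interval m p q w.
Proof.
move=> /itvE uvw /itvE wup /itvE wvq.
have uvw' : m u v w = w by rewrite -med_rot.
have pvw : m v p w = w.
  by rewrite med_swapl -wup med_distr med_xyx uvw' med_yxx.
by rewrite /median_interval /= med_swapl -wvq med_distr med_xyx pvw med_yxx.
Qed.

(** Let [w] lie between [u] on [[x, z]] and [v] on [[y, z]].  It then lies
    between its gates in these two intervals, and distributivity turns this
    into [w] being in [[m x y w, z]], where [m x y w] is in [H]. *)
Lemma convex_join (H : set T) z :
  median_convex m H ->
  median_convex m (\bigcup_(x in H) median_interval m x z).
Proof.
move=> cH u v [x Hx xzu] [y Hy yzv] w uvw.
exists (m x y w); first exact: convex_med.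
have : median_interval m (m w x z) (m w y z) w.
  by apply: (itv_trim uvw); exact: itv_gate.
move=> /itvE e; apply/itvE; rewrite -[RHS]e med_swapl -(med_rot w x y).
by rewrite med_distr (med_swapl x) (med_swapl y).
Qed.

Lemma maximal_convex (A B : set T) :
  median_convex m A -> A !=set0 -> A `&` B = set0 ->
  exists H, [/\ median_convex m H, A `<=` H, H `&` B = set0 &
    forall H', median_convex m H' -> H `<=` H' -> H' `&` B = set0 -> H' = H].
Proof.
move=> cA [a Aa] AB0.
(* [A `<=` X] is asked only of nonempty [X] because the empty chain has union
   [set0], which must satisfy [P]. *)
pose P X := [/\ median_convex m X, X `&` B = set0 & X !=set0 -> A `<=` X].
have [F FP Ftot|H [[cH HB0 HA] Hmax]] := @Zorn_bigcup T P.
  split.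
  - move=> x y [X FX Xx] [Y FY Yy] u uxy.
    have [XY|YX] := Ftot _ _ FX FY; [exists Y|exists X] => //.
      by have [cY _ _] := FP _ FY; apply: (cY x y) => //; exact: XY.
    by have [cX _ _] := FP _ FX; apply: (cX x y) => //; exact: YX.
  - rewrite -subset0 => x [[X FX Xx] Bx].
    by have [_ XB _] := FP _ FX; rewrite -XB.
  - move=> [x [X FX Xx]]; have [_ _ AX] := FP _ FX.
    by move=> y Ay; exists X => //; apply: AX Ay; exists x.
have H0 : H !=set0.
  apply/set0P/negP => /eqP H0; apply: (Hmax A); last by split=> // _ x.
  by rewrite H0; split=> // /(_ _ Aa).
exists H; split=> //; first exact: HA.
move=> H' cH' HH' H'B; apply: contrapT => neq; apply: (Hmax H').
  by split=> // H'H; apply: neq; rewrite eqEsubset.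
by split=> // _; apply: subset_trans HH'; exact: HA.
Qed.

(** Take a maximal convex set disjoint from the other side, twice.  A point
    outside both could be joined to neither side without meeting the other
    one, and Pasch's axiom forbids both meetings at once. *)
Lemma halfspace_separation (A B : set T) :
  median_convex m A -> median_convex m B -> A !=set0 -> B !=set0 ->
  A `&` B = set0 ->
  exists H, [/\ halfspace m H, A `<=` H & B `<=` ~` H].
Proof.
move=> cA cB A0 B0 AB.
have [H [cH AH HB Hmax]] := maximal_convex cA A0 AB.
have [|K [cK BK KH Kmax]] := maximal_convex cB B0 (B := H).
  by rewrite setIC.
have H0 := subset_nonempty AH A0; have K0 := subset_nonempty BK B0.
have meet (X Y : set T) z : median_convex m X -> X !=set0 -> ~ X z ->
    (forall X', median_convex m X' -> X `<=` X' -> X' `&` Y = set0 -> X' = X) ->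
  exists x y, [/\ X x, Y y & median_interval m x z y].
  move=> cX [x0 Xx0] nXz Xmax; apply: contrapT => nex; apply: nXz.
  rewrite -(Xmax _ (@convex_join _ z cX)).
  - by exists x0 => //; exact: itv_r.
  - by move=> x Xx; exists x => //; exact: itv_l.
  - by rewrite -subset0 => y [[x Xx xzy] Yy]; apply: nex; exists x, y.
have HK : ~` H `<=` K.
  move=> z nHz; apply: contrapT => nKz.
  have [x [k [Hx Kk xzk]]] :
      exists x y, [/\ H x, K y & median_interval m x z y].
    apply: meet => // X' cX' HX' X'K; apply: Hmax => //.
    by apply: subsetI_eq0 X'K.
  have [y [h [Ky Hh yzh]]] :
      exists x y, [/\ K x, H y & median_interval m x z y].
    by apply: meet => // X' cX' KX' X'H; exact: Kmax.
  have [p [xhp ykp]] := pasch yzh xzk.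
  have : (K `&` H) p by split; [exact: (cK y k)|exact: (cH x h)].
  by rewrite KH.
have KHc : ~` H = K.
  rewrite eqEsubset; split=> // x Kx Hx.
  by have : (K `&` H) x by []; rewrite KH.
by exists H; split=> //; [split=> //|]; rewrite KHc.
Qed.

End MedianAlgebra.

(** * Compact median algebras: Helly's theorem, gates, cuts *)

Lemma compact_bigcap (T : topologicalType) (I : choiceType) (D : set I)
    (F : I -> set T) (t0 : T) :
  compact [set: T] -> (forall i, D i -> closed (F i)) -> finI D F ->
  \bigcap_(i in D) F i !=set0.
Proof.
pose pT : ptopologicalType := HB.pack T (isPointed.Build T t0).
move=> cT clF fF.
have : compact [set: pT] by [].
rewrite compact_In0; apply => //.
by exists F => // i Di; rewrite setTI.
Qed.

Definition closed_cut (M : topologicalType) (m : M -> M -> M -> M)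
    (A B : set M) : Prop :=
  [/\ closed A, median_convex m A, closed B, median_convex m B
    & A `|` B = setT].

Section CompactMedian.
Context {M : topologicalType} {m : M -> M -> M -> M}.
Context (tm : topological_median m) (cptM : compact [set: M]).

Let med : is_median m. Proof. by case: tm. Qed.
Let hM : hausdorff_space M. Proof. by case: tm. Qed.

Lemma med_cvg (T : topologicalType) (F : set_system T) (f g h : T -> M) x y z :
  Filter F -> f @ F --> x -> g @ F --> y -> h @ F --> z ->
  (fun t => m (f t) (g t) (h t)) @ F --> m x y z.
Proof.
move=> FF fx gy hz; have [_ _ /(_ (x, y, z)) mc] := tm.
have fgh : (fun t => (f t, g t, h t)) @ F --> nbhs (x, y, z).
  apply: (@cvg_pair _ (M * M)%type M F (nbhs (x, y)) (nbhs z) _ _ _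
    (fun t => (f t, g t)) h) => //.
  exact: (@cvg_pair _ M M F (nbhs x) (nbhs y) _ _ _ f g).
by move=> P /mc P'; exact: fgh P'.
Qed.

Lemma closed_itv x y : closed (median_interval m x y).
Proof.
move=> u clu; apply: hM => A B mA uB.
have mc : (fun v => m x y v) @ nbhs u --> m x y u.
  by apply: med_cvg; [exact: cvg_cst|exact: cvg_cst|exact: cvg_id].
have [v [xyv [Av Bv]]] := clu _ (filterI (mc _ mA : nbhs u _) uB).
by exists v; split=> //; rewrite -xyv.
Qed.

Lemma closure_convex (A : set M) :
  median_convex m A -> median_convex m (closure A).
Proof.
move=> cA x y clx cly u xyu W; rewrite -xyu => Wn.
have [_ _ /(_ (x, y, u)) /(_ _ Wn)] := tm.
move=> [[P Q] /= [[[P1 P2] /= [xP1 yP2] PP] uQ] PQ].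
have [a [Aa Pa]] := clx _ xP1; have [b [Ab Pb]] := cly _ yP2.
exists (m a b u); split; first exact: (convex_med med _ cA).
suff : (P `*` Q) (a, b, u) by move/PQ.
by split=> /=; [apply: PP|exact: nbhs_singleton uQ].
Qed.

Lemma compact_helly (I : choiceType) (D : set I) (F : I -> set M) (t0 : M) :
  (forall i, D i -> closed (F i)) -> (forall i, D i -> median_convex m (F i)) ->
  (forall i j, D i -> D j -> F i `&` F j !=set0) ->
  \bigcap_(i in D) F i !=set0.
Proof.
move=> clF cF FF; apply: compact_bigcap => // D' D'D.
have DD i : i \in D' -> D i by move=> /D'D /set_mem.
have [|||||x [_ Fx]] := @helly_seq _ _ med _ (D' : seq I) F setT.
- by move=> *.
- by exists t0.
- by move=> i /DD; exact: cF.
- by move=> i /DD Di; rewrite setTI; have := FF _ _ Di Di; rewrite setIid.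
- by move=> i j /DD Di /DD; exact: FF.
by exists x.
Qed.

(** The sets [A `&` [q, x]], for [x] in [A], meet pairwise: [m q x y] belongs to
    the ones for [x] and for [y]. *)
Lemma gate_exists (A : set M) q :
  closed A -> median_convex m A -> A !=set0 ->
  exists2 q', A q' & forall x, A x -> median_interval m q x q'.
Proof.
move=> clA cA [a Aa].
have [|||x Fx] := @compact_helly M A (fun x => A `&` median_interval m q x) q.
- by move=> i _; apply: closedI => //; exact: closed_itv.
- by move=> i _; apply: convexI => //; exact: itv_convex.
- move=> x y Ax Ay; exists (m q x y).
  have Am : A (m q x y) by rewrite (med_rot med); exact: (convex_med med _ cA).
  by split; split=> //; [exact: itv_med|exact: itv_med_xz].
by exists x; [case: (Fx _ Aa)|move=> y /Fx[]].
Qed.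

Context (loc : locally_open_convex m).

(** Disjoint convex neighborhoods of the two points lie on the two sides of
    some pair of complementary half-spaces; the closures of these half-spaces
    still miss the opposite neighborhood. *)
Lemma cut_separates_points p q :
  p <> q -> exists A B, [/\ closed_cut m A B, ~ B p & ~ A q].
Proof.
move=> pq.
have [[U V]] : exists UV : set M * set M,
    [/\ nbhs p UV.1, nbhs q UV.2 & UV.1 `&` UV.2 = set0].
  apply: contrapT => nex; apply: pq; apply: hM => U V pU qV.
  by apply: contrapT => /set0P/negP/negPn/eqP UV; apply: nex; exists (U, V).
move=> /= [/loc[U' [[oU Up] cU U'U]] /loc[V' [[oV Vq] cV V'V]] UV].
have UV' : U' `&` V' = set0 by exact: subsetI_eq0 UV.
have [||H [[cH cHc] UH VH]] := halfspace_separation med cU cV _ _ UV'.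
- by exists p.
- by exists q.
exists (closure H), (closure (~` H)); split.
- split; do ?[exact: closed_closure|exact: closure_convex].
  rewrite -subTset => x _.
  by have [Hx|Hx] := pselect (H x); [left|right]; exact: subset_closure.
- by move=> /(_ U') []; [exact: open_nbhs_nbhs|move=> x [nHx /UH]].
- by move=> /(_ V') []; [exact: open_nbhs_nbhs|move=> x [Hx /VH]].
Qed.

(** It suffices to cut [q] from its gate in [A]: a point of [A] beyond this
    cut would put the gate beyond it, too. *)
Lemma cut_separates_convex A q : closed A -> median_convex m A -> A !=set0 ->
  ~ A q -> exists A' B', [/\ closed_cut m A' B', ~ A' q & A `&` B' = set0].
Proof.
move=> clA cA A0 nAq; have [q' Aq' gate] := gate_exists q clA cA A0.
have [|A' [B' [cAB nBq' nA'q]]] := @cut_separates_points q' q.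
  by move=> e; apply: nAq; rewrite -e.
exists A', B'; split=> //; rewrite -subset0 => x [Ax Bx]; apply: nBq'.
have [_ _ _ cB AB] := cAB; apply: (cB q x) => //; last exact: gate.
by have : setT q by []; rewrite -AB => -[].
Qed.

End CompactMedian.

Local Open Scope ring_scope.

(** * Invariant states on minimal systems *)

(** The functional form of an invariant regular probability measure on a
    compact space: [lam] is integration of continuous functions. *)
Definition invariant_state (R : realType) (G : Type) (M : topologicalType)
    (act : G -> M -> M) (lam : (M -> R) -> R) : Prop :=
  [/\ (forall (a : R) (f g : M -> R), continuous f -> continuous g ->
         lam (fun x => a * f x + g x) = a * lam f + lam g),
      (forall f : M -> R, continuous f -> (forall x, 0 <= f x) -> 0 <= lam f),
      lam (fun=> 1) = 1 &
      (forall (h : G) (f : M -> R), continuous f ->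
         lam (fun x => f (act h x)) = lam f)].

Definition invariant_subsystem (G : Type) (M : topologicalType)
    (m : M -> M -> M -> M) (act : G -> M -> M) (N : set M) : Prop :=
  [/\ closed N, N !=set0, subalgebra m N & forall g x, N x -> N (act g x)].

Definition minimal_system (G : Type) (M : topologicalType)
    (m : M -> M -> M -> M) (act : G -> M -> M) : Prop :=
  forall N : set M, invariant_subsystem m act N -> N = [set: M].

Section Minimal.
Context {R : realType} {G : topologicalGroupType} {M : topologicalType}.
Context {m : M -> M -> M -> M} {act : G -> M -> M} {lam : (M -> R) -> R}.
Context (tm : topological_median m) (cptM : compact [set: M]).
Context (acts : acts_by_continuous_automorphisms m act).
Context (state : invariant_state act lam).
Context (min : minimal_system m act) (x0 : M).

Let med : is_median m. Proof. by case: tm. Qed.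
Let hM : hausdorff_space M. Proof. by case: tm. Qed.

Implicit Types (f g h : M -> R) (A B C D F : set M).

Lemma state1 : lam (fun=> 1) = 1. Proof. by case: state. Qed.

Lemma state_ge0 f : continuous f -> (forall x, 0 <= f x) -> 0 <= lam f.
Proof. by case: state => _ + _ _; apply. Qed.

Lemma state_act (g : G) f : continuous f -> lam (fun x => f (act g x)) = lam f.
Proof. by case: state => _ _ _; apply. Qed.

Lemma stateD f g : continuous f -> continuous g ->
  lam (fun x => f x + g x) = lam f + lam g.
Proof.
move=> cf cg; case: state => lin _ _ _; rewrite -[lam f]mul1r -lin //.
by congr lam; apply/funext => x; rewrite mul1r.
Qed.

Lemma state0 : lam (fun=> 0) = 0.
Proof.
have c0 : continuous (fun _ : M => 0 : R) by move=> x; exact: cvg_cst.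
have := stateD c0 c0.
under eq_fun do rewrite addr0.
by move/eqP; rewrite -[X in X == _]addr0 (inj_eq (addrI _)) => /eqP.
Qed.

Lemma stateZ a f : continuous f -> lam (fun x => a * f x) = a * lam f.
Proof.
move=> cf; case: state => lin _ _ _.
have c0 : continuous (fun _ : M => 0 : R) by move=> x; exact: cvg_cst.
by have := lin a _ _ cf c0; under eq_fun do rewrite addr0; rewrite state0 addr0.
Qed.

Lemma stateB f g : continuous f -> continuous g ->
  lam (fun x => f x - g x) = lam f - lam g.
Proof.
move=> cf cg; case: state => lin _ _ _; rewrite addrC -mulN1r -lin //.
by congr lam; apply/funext => x; rewrite mulN1r addrC.
Qed.

Lemma state_le f g : continuous f -> continuous g ->
  (forall x, f x <= g x) -> lam f <= lam g.
Proof.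
move=> cf cg fg; rewrite -subr_ge0 -stateB //; apply: state_ge0.
  by move=> x; apply: cvgB; [exact: cg|exact: cf].
by move=> x; rewrite subr_ge0.
Qed.

(** The measure of a closed set [F] is the infimum of [lam f] over the functions
    [f] below.  Being heavy lies between having measure more than 1/2 and having
    measure at least 1/2, as the strict inequality is asked of each [f] and not
    of the infimum.  With this choice two heavy sets still cannot be disjoint,
    and a set that is not heavy comes with a function witnessing it. *)
Definition heavy (F : set M) : Prop :=
  forall f : M -> R, continuous f -> (forall x, 0 <= f x) ->
    (forall x, F x -> 1 <= f x) -> 2^-1 < lam f.

Definition half (F : set M) : Prop :=
  forall f : M -> R, continuous f -> (forall x, 0 <= f x) ->
    (forall x, F x -> 1 <= f x) -> 2^-1 <= lam f.

Lemma separating_function A B : closed A -> closed B -> A `&` B = set0 ->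
  exists f : M -> R, [/\ continuous f, forall x, 0 <= f x <= 1,
    forall x, A x -> f x = 0 & forall x, B x -> f x = 1].
Proof.
move=> clA clB AB.
have [f [cf fA fB f01]] :=
  urysohn_ext_itv (compact_normal hM cptM) clA clB AB (@ltr01 R).
exists f; split=> // x; first by have /f01 := imageT f x; rewrite /= in_itv.
  by move=> Ax; apply: fA; exists x.
by move=> Bx; apply: fB; exists x.
Qed.

(** If [A] and [B] were disjoint, [f] and [1 - f] would both have mean greater
    than 1/2 for a function [f] separating them. *)
Lemma heavy_meet A B : closed A -> closed B -> heavy A -> heavy B ->
  A `&` B !=set0.
Proof.
move=> clA clB hA hB; apply: contrapT => /set0P/negP/negPn/eqP AB.
have [f [cf f01 fA fB]] := separating_function clA clB AB.
have c1 : continuous (fun _ : M => 1 : R) by move=> x; exact: cvg_cst.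
have lf : 2^-1 < lam f.
  by apply: hB => // x; [case/andP: (f01 x)|move=> /fB ->].
have : 2^-1 < lam (fun x => 1 - f x).
  apply: hA => x.
  - by apply: cvgB; [exact: c1|exact: cf].
  - by rewrite subr_ge0; case/andP: (f01 x).
  - by move=> /fA ->; rewrite subr0.
rewrite stateB // state1.
by lra.
Qed.

Lemma act_cont (g : G) : continuous (act g).
Proof. by case: acts => _ _ /(_ g)[]. Qed.

Lemma act_med (g : G) x y z : act g (m x y z) = m (act g x) (act g y) (act g z).
Proof. by case: acts => _ _ /(_ g)[[_ +] _] _; apply. Qed.

Lemma act_invK (g : G) x : act g (act g^-1%g x) = x.
Proof. by case: acts => a1 aM _ _; rewrite -aM mulgV a1. Qed.

Lemma act_preimage_convex (g : G) (A : set M) :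
  median_convex m A -> median_convex m (act g @^-1` A).
Proof.
move=> cA x y Ax Ay u xyu; apply: (cA _ _ Ax Ay).
by rewrite /median_interval /= -act_med xyu.
Qed.

(** The heavy closed convex sets meet pairwise, hence all at once by Helly's
    theorem; their intersection is invariant, so by minimality it is
    everything. *)
Lemma heavy_full A : closed A -> median_convex m A -> heavy A -> A = setT.
Proof.
move=> clA cA hA.
pose D := [set F : set M | [/\ closed F, median_convex m F & heavy F]].
suff : \bigcap_(F in D) F = setT.
  by move=> DT; rewrite -subTset -DT => x Dx; apply: Dx.
apply: min; split.
- by apply: closed_bigI => F [].
- apply: (compact_helly tm cptM x0) => [F []//|F []//|F F' [? _ ?] [? _ ?]].
  exact: heavy_meet.
- move=> x y z Dx Dy Dz F [? cF ?].
  by apply: (convex_med med _ cF); [exact: Dx|exact: Dy].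
- move=> g x Dx F [clF cF hF]; apply: (Dx (act g @^-1` F)); split.
  + by apply: preimage_closed => // y _; exact: act_cont.
  + exact: act_preimage_convex.
  + move=> f cf f0 fF; rewrite -(state_act g^-1%g cf); apply: hF => //.
      by move=> y; apply: continuous_comp; [exact: act_cont|exact: cf].
    by move=> y Fy; apply: fF; rewrite /= act_invK.
Qed.

(** [A] is not heavy, so some [f] that is at least 1 on [A] has mean at most
    1/2; as [f + g >= 1], the mean of [g] is at least 1/2. *)
Lemma cut_half A B : closed_cut m A B -> A <> setT -> half B.
Proof.
move=> [clA cA _ _ AB] AT g cg g0 gB.
apply: contrapT => /negP; rewrite -ltNge => lg.
apply: AT; apply: heavy_full => // f cf f0 fA.
have : 1 <= lam (fun x => f x + g x).
  rewrite -state1; apply: state_le.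
  - by move=> x; exact: cvg_cst.
  - by move=> x; apply: cvgD; [exact: cf|exact: cg].
  - move=> x; have : setT x by []; rewrite -AB => -[/fA fx|/gB gx].
      by have := g0 x; lra.
    by have := f0 x; lra.
by rewrite stateD //; lra.
Qed.

Lemma cutC A B : closed_cut m A B -> closed_cut m B A.
Proof. by move=> [? ? ? ? AB]; split=> //; rewrite setUC. Qed.

Definition null (f : M -> R) : Prop :=
  [/\ continuous f, forall x, 0 <= f x & lam f <= 0].

(** [null] consists of nonnegative functions, so these are the points where all
    null functions vanish: the support of the measure. *)
Definition support : set M := [set x | forall f, null f -> f x <= 0].

(** By compactness it is enough to treat finitely many null functions.  Their
    sum is null, hence cannot be greater than 1 everywhere. *)
Lemma support_nonempty : support !=set0.
Proof.
have nullZ a f : 0 <= a -> null f -> null (fun x => a * f x).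
  move=> a0 [cf f0 lf]; split=> [x|x|]; first by apply: cvgMr; exact: cf.
    exact: mulr_ge0.
  by rewrite stateZ // mulr_ge0_le0.
have dominated (s : seq (M -> R)) : (forall f, f \in s -> null f) ->
    exists2 g, null g & forall f, f \in s -> forall x, f x <= g x.
  elim: s => [_|f s IH fs].
    exists (fun=> 0) => //; split=> //; first by move=> x; exact: cvg_cst.
    by rewrite state0.
  have [|g [cg g0 lg] gs] := IH.
    by move=> h hs; apply: fs; rewrite inE hs orbT.
  have [|cf f0 lf] := fs f; first by rewrite inE eqxx.
  exists (fun x => f x + g x).
    split=> [x|x|]; first by apply: cvgD; [exact: cf|exact: cg].
      exact: addr_ge0.
    by rewrite stateD //; lra.
  move=> h; rewrite inE => /predU1P[->|/gs hg] x; first by rewrite lerDl.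
  by rewrite (le_trans (hg x)) // lerDr.
(* As [null] is a cone, bounding all its members by 1 at a point forces them to
   be nonpositive there. *)
have [|D' D'D|x Hx] := @compact_bigcap M (M -> R) null
    (fun f => [set x | f x <= 1]) x0 cptM.
- move=> f [cf _ _]; apply: (@preimage_closed _ _ f [set t | t <= 1]) => [y _|].
    exact: cf.
  exact: closed_le.
- have [|g [cg g0 lg] gD] := dominated D'; first by move=> f /D'D /set_mem.
  have [x gx] : exists x, g x <= 1.
    apply: contrapT => /forallNP ng.
    suff : lam (fun=> 1) <= lam g by rewrite state1; lra.
    apply: state_le => // [x|x]; first exact: cvg_cst.
    by have /negP := ng x; rewrite -ltNge => /ltW.
  by exists x => f /gD fg; exact: le_trans (fg x) gx.
exists x => f nf; rewrite leNgt; apply/negP => fx.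
have : 2 / f x * f x <= 1.
  apply: (Hx (fun y => 2 / f x * f y)); apply: nullZ => //.
  by rewrite divr_ge0 ?ltW.
by rewrite divfK ?gt_eqF //; lra.
Qed.

Lemma support_act (g : G) x : support x -> support (act g x).
Proof.
move=> Sx f [cf f0 lf]; apply: (Sx (fun y => f (act g y))); split=> //.
  by move=> y; apply: continuous_comp; [exact: act_cont|exact: cf].
by rewrite state_act.
Qed.

(** A function [f] with values in [0, 1] that vanishes on [C `|` D] is null: a
    function [u] separating [C] from [D] splits [1 - f] into two parts, one at
    least 1 on [C] and the other on [D], so that [1 - f] has mean at least 1. *)
Lemma support_sub C D : closed C -> closed D -> C `&` D = set0 ->
  half C -> half D -> support `<=` C `|` D.
Proof.
move=> clC clD CD hC hD x Sx; apply: contrapT => nx.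
have [f [cf f01 fE fx]] : exists f : M -> R,
    [/\ continuous f, forall x, 0 <= f x <= 1,
    forall x, (C `|` D) x -> f x = 0 & forall y, [set x] y -> f y = 1].
  apply: separating_function; first exact: closedU.
    exact/accessible_closed_set1/hausdorff_accessible.
  by rewrite -subset0 => y [Ey /= yx]; apply: nx; rewrite -yx.
suff lf : lam f <= 0.
  have nf : null f by split=> // y; case/andP: (f01 y).
  by have := Sx f nf; rewrite fx //; lra.
have [u [cu u01 uC uD]] := separating_function clC clD CD.
have c1 : continuous (fun _ : M => 1 : R) by move=> y; exact: cvg_cst.
have cf' : continuous (fun y => 1 - f y).
  by move=> y; apply: cvgB; [exact: c1|exact: cf].
have cu' : continuous (fun y => 1 - u y).
  by move=> y; apply: cvgB; [exact: c1|exact: cu].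
have cuf : continuous (fun y => u y * (1 - f y)).
  by move=> y; apply: cvgM; [exact: cu|exact: cf'].
have cuf' : continuous (fun y => (1 - u y) * (1 - f y)).
  by move=> y; apply: cvgM; [exact: cu'|exact: cf'].
have lD : 2^-1 <= lam (fun y => u y * (1 - f y)).
  apply: hD => // y.
    by rewrite mulr_ge0 ?subr_ge0 //; [case/andP: (u01 y)|case/andP: (f01 y)].
  by move=> Dy; rewrite uD // fE ?subr0 ?mulr1 //; right.
have lC : 2^-1 <= lam (fun y => (1 - u y) * (1 - f y)).
  apply: hC => // y.
    by rewrite mulr_ge0 ?subr_ge0 //; [case/andP: (u01 y)|case/andP: (f01 y)].
  by move=> Cy; rewrite uC // fE ?subr0 ?mulr1 //; left.
have := stateD cuf cuf'.
have -> : (fun y => u y * (1 - f y) + (1 - u y) * (1 - f y)) =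
    (fun y => 1 - f y).
  by apply/funext => y; rewrite -mulrDl addrC subrK mul1r.
by rewrite stateB // state1; lra.
Qed.

(** The points whose orbit stays in [C `|` D] form an invariant closed
    subalgebra that contains the support. *)
Lemma half_cover C D : closed C -> closed D ->
  median_convex m C -> median_convex m D -> C `&` D = set0 ->
  half C -> half D -> C `|` D = setT.
Proof.
move=> clC clD cC cD CD hC hD.
pose N := \bigcap_g (act g @^-1` (C `|` D)).
suff : N = setT.
  move=> NT; rewrite -subTset -NT => x /(_ 1%g I) /=.
  by case: acts => -> .
have [s Ss] := support_nonempty.
apply: min; split.
- apply: closed_bigI => g _; apply: preimage_closed.
    by move=> y _; exact: act_cont.
  exact: closedU.
- by exists s => g _; apply: support_sub => //; exact: support_act.
- move=> x y z Nx Ny Nz g _; rewrite /= act_med.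
  by apply: (subalgebraU med cC cD); [exact: Nx|exact: Ny|exact: Nz].
- by move=> g x Nx h _; rewrite /=; case: acts => _ <- _ _; exact: Nx.
Qed.

Context (loc : locally_open_convex m).

Lemma clopen_halfspace_cut (H : set M) :
  clopen H -> halfspace m H -> closed_cut m H (~` H).
Proof.
by move=> [oH clH] [cH cHc]; split=> //; [exact: open_closedC|rewrite setUv].
Qed.

(** Two successive cuts between [p] and [q] leave disjoint outer sides, each
    of which is a half; by minimality nothing is left between them. *)
Lemma minimal_separated (p q : M) : p <> q ->
  exists H, [/\ clopen H, halfspace m H, H p & ~ H q].
Proof.
move=> pq; have [A [B [cAB nBp nAq]]] := cut_separates_points tm loc pq.
have [clA cA clB cB AB] := cAB.
have Ap : A p by have : setT p by []; rewrite -AB => -[].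
have [|A' [B' [cAB' nA'q A'B]]] :=
  cut_separates_convex tm cptM loc clA cA _ nAq; first by exists p.
have [_ _ clB' cB' _] := cAB'.
have AB' : A `|` B' = setT.
  apply: half_cover => //.
    by apply: (cut_half (cutC cAB)) => BT; apply: nBp; rewrite BT.
  by apply: (cut_half cAB') => AT; apply: nA'q; rewrite AT.
have AcB' : ~` A = B'.
  rewrite eqEsubset; split=> x.
    by move=> nAx; have : setT x by []; rewrite -AB' => -[].
  by move=> B'x Ax; have : (A `&` B') x by []; rewrite A'B.
exists A; split=> //; last by split=> //; rewrite AcB'.
by split=> //; rewrite -(setCK A); apply: closed_openC; rewrite AcB'.
Qed.

(** [H] and [~` K] are disjoint closed convex sets of mass at least 1/2, so they
    cover the space. *)
Lemma minimal_antichain (H K : set M) :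
  clopen H -> clopen K -> halfspace m H -> halfspace m K ->
  H !=set0 -> K <> setT -> H `<=` K -> H = K.
Proof.
move=> cH cK hH hK [h Hh] KT HK; rewrite eqEsubset; split=> // x Kx.
have HKc : H `|` ~` K = setT.
  have [clH cxH _ _ _] := clopen_halfspace_cut cH hH.
  have [_ _ clKc cxKc _] := clopen_halfspace_cut cK hK.
  apply: half_cover => //.
  - by rewrite -subset0 => y [/HK].
  - by apply: (cut_half (cutC (clopen_halfspace_cut cH hH))) => HT;
      have : setT h by []; rewrite -HT.
  - exact: (cut_half (clopen_halfspace_cut cK hK)).
by have : setT x by []; rewrite -HKc => -[].
Qed.

End Minimal.

(** * Recognizing cubes *)

Lemma continuous_inverse (S T : topologicalType) (e : S -> T) (f : T -> S) :
  compact [set: S] -> hausdorff_space T -> continuous e ->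
  cancel e f -> cancel f e -> continuous f.
Proof.
move=> cS hT ce eK fK; apply/continuous_closedP => K clK.
have -> : f @^-1` K = e @` K.
  rewrite eqEsubset; split=> [y Ky|_ [x Kx <-]]; last by rewrite /= eK.
  by exists (f y) => //; rewrite fK.
apply: compact_closed => //; apply: continuous_compact.
  exact: continuous_subspaceT.
exact: subclosed_compact cS _.
Qed.

Lemma halfspace_maj (T : Type) (m : T -> T -> T -> T) (H : set T) x y z :
  is_median m -> halfspace m H ->
  `[< H (m x y z) >] = maj `[< H x >] `[< H y >] `[< H z >].
Proof.
move=> med [cH cHc].
have two a b c : H a -> H b -> H (m a b c) by exact: (convex_med med c cH).
have twoC a b c : ~ H a -> ~ H b -> ~ H (m a b c).
  by exact: (convex_med med c cHc).
rewrite /maj.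
have [Hx|Hx] := asboolP (H x); have [Hy|Hy] := asboolP (H y);
  have [Hz|Hz] := asboolP (H z); rewrite /=;
  first [exact/asboolP/two|exact/asboolPn/twoC
  |by rewrite (med_swap med); first [exact/asboolP/two|exact/asboolPn/twoC]
  |by rewrite (med_rot med); first [exact/asboolP/two|exact/asboolPn/twoC]].
Qed.

(** The half-spaces avoiding [o] represent each complementary pair of
    half-spaces once; they are the coordinates of the cube. *)
Lemma cube_criterion (M : topologicalType) (m : M -> M -> M -> M) (o : M) :
  topological_median m -> @second_countable M -> compact [set: M] ->
  (forall p q, p <> q -> exists H, [/\ clopen H, halfspace m H, H p & ~ H q]) ->
  (forall H K, clopen H -> clopen K -> halfspace m H -> halfspace m K ->
     H !=set0 -> K <> setT -> H `<=` K -> H = K) ->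
  is_cube m setT.
Proof.
move=> tm scM cptM sep anti; have [med hM _] := tm.
pose W := [set H : set M | [/\ clopen H, halfspace m H, H !=set0 & ~ H o]].
have countW : countable W.
  pose pM : ptopologicalType := HB.pack M (isPointed.Build M o).
  apply: (sub_countable _ (@clopen_countable pM cptM scM)).
  by apply: subset_card_le => H [].
pose e (x : M) : {ptws W -> bool} := fun i => `[< set_val i x >].
have hsC H : halfspace m H -> halfspace m (~` H).
  by move=> [cH cHc]; split; rewrite ?setCK.
have clC (H : set M) : clopen H -> clopen (~` H).
  by move=> [oH cH]; split; [exact: closed_openC|exact: open_closedC].
have inW (i : W) : W (set_val i) by exact: set_valP.
have e_inj : injective e.
  move=> p q epq; apply: contrapT => /sep[H [clH hsH Hp nHq]].
  wlog nHo : p q epq H clH hsH Hp nHq / ~ H o.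
    move=> gen; have [Ho|nHo] := pselect (H o); last exact: (gen p q epq H).
    apply: (gen q p (esym epq) (~` H)) => //; [exact: clC|exact: hsC].
  have WH : W H by split=> //; exists p.
  have /(congr1 (fun s => s (SigSub (mem_set WH)))) := epq.
  by rewrite /e /= (asboolT Hp) asboolF.
have e_surj s : exists x, e x = s.
  pose F (i : W) := if s i then set_val i else ~` set_val i.
  have clF i : clopen (F i).
    by have [? _ _ _] := inW i; rewrite /F; case: ifP => // _; exact: clC.
  have hsF i : halfspace m (F i).
    by have [_ ? _ _] := inW i; rewrite /F; case: ifP => // _; exact: hsC.
  have [||i j _ _|x Fx] := @compact_helly _ _ tm cptM W setT F o.
  - by move=> i _; have [] := clF i.
  - by move=> i _; have [] := hsF i.
  - (* Two chosen sides can be disjoint only if one of the two half-spaces lies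
       in the other or in its complement; [anti] excludes this, since both
       half-spaces avoid [o]. *)
    have Ho (k : W) : ~ set_val k o by have [] := inW k.
    have [->|ij] := eqVneq i j.
      rewrite setIid /F; case: (s j); last by exists o; exact: Ho.
      by have [_ _ ? _] := inW j.
    have nsub (k l : W) : set_val k `<=` set_val l -> k = l.
      have [ck hk k0 _] := inW k; have [cl hl _ _] := inW l.
      move=> kl; apply/val_inj; apply: (anti _ _ ck cl hk hl k0) kl => lT.
      by apply: (Ho l); rewrite lT.
    apply: contrapT => /set0P/negP/negPn/eqP; rewrite -subset0 /F => FF.
    case: (s i) (s j) FF => [] [] FF.
    + have [ci hi i0 _] := inW i; have [cj hj [y jy] _] := inW j.
      have /seteqP[_ ji] : set_val i = ~` set_val j.
        apply: anti => //; [exact: clC|exact: hsC| |].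
          by move=> jT; have : setT y by []; rewrite -jT.
        by move=> x ix jx; exact: (FF x).
      exact: (Ho i (ji o (Ho j))).
    + move/eqP: ij; apply; apply: nsub => x ix.
      by apply: contrapT => jx; exact: (FF x).
    + move/eqP: ij; apply; apply/esym/nsub => x jx.
      by apply: contrapT => ix; exact: (FF x).
    + by apply: (FF o); split; exact: Ho.
  exists x; apply/funext => i; have := Fx i I; rewrite /F /e.
  by case: (s i) => ?; [exact: asboolT|exact: asboolF].
have [f fK] : exists f : {ptws W -> bool} -> M, cancel f e.
  by exists (fun s => projT1 (cid (e_surj s))) => s; case: cid.
have eK : cancel e f by move=> x; apply: e_inj; rewrite fK.
exists W, f; split.
- have /countable_injP[g ginj] := countW.
  apply/countable_injP; exists (fun i : W => g (set_val i)) => i j _ _ gij.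
  by apply/val_inj/ginj => //; exact/mem_set/inW.
- exact: can_inj fK.
- apply: (@continuous_inverse M {ptws W -> bool} e f) => //.
    apply: (@hausdorff_product W (fun=> bool)) => _.
    exact: discrete_hausdorff.
  move=> x; apply/cvg_sup => i U [B [[A oA <-] Ax AU]].
  have [cl_i _ _ _] := inW i.
  have xi : nbhs x [set y | e y i = e x i].
    rewrite [e x i]/e; have [ix|ix] := asboolP (set_val i x).
      apply: filterS (open_nbhs_nbhs (conj cl_i.1 ix)) => y; exact: asboolT.
    apply: filterS (open_nbhs_nbhs (conj (clC _ cl_i).1 ix)) => y.
    exact: asboolF.
  by apply: filterS xi => y /= yx; apply: AU; rewrite /= yx.
- move=> a b c; apply: e_inj; rewrite fK; apply/funext => i.
  have [_ hs _ _] := inW i.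
  by rewrite /e (halfspace_maj _ _ _ med hs) -!/(e _ _) !fK.
- by rewrite eqEsubset; split=> // x _; exists (e x).
Qed.

(** * Minimal systems *)

Lemma minimal_system_cube (R : realType) (G : topologicalGroupType)
    (M : topologicalType) (m : M -> M -> M -> M) (act : G -> M -> M)
    (lam : (M -> R) -> R) (o : M) :
  sclocc m -> acts_by_continuous_automorphisms m act ->
  invariant_state act lam -> minimal_system m act ->
  is_cube m [set: M].
Proof.
move=> [tm scM loc cptM] acts state min; apply: (cube_criterion o) => //.
  exact: (minimal_separated tm cptM acts state min o loc).
exact: (minimal_antichain tm cptM acts state min o).
Qed.

(** Zorn's lemma is applied to the complements of subsystems, ordered by
    inclusion; compactness keeps the intersection of a chain nonempty. *)
Lemma minimal_subsystem_exists (G : Type) (M : topologicalType)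
    (m : M -> M -> M -> M) (act : G -> M -> M) (o : M) :
  compact [set: M] ->
  exists2 N, invariant_subsystem m act N &
    forall N', invariant_subsystem m act N' -> N' `<=` N -> N' = N.
Proof.
move=> cptM; pose P U := invariant_subsystem m act (~` U).
have [F FP Ftot|U [PU Umax]] := @Zorn_bigcup M P.
  rewrite /P setC_bigcup; split.
  - by apply: closed_bigI => X /FP[].
  - apply: (compact_bigcap o cptM) => [X /FP[//]|D D_F].
    have chain_ub (s : seq (set M)) : (forall X, X \in s -> F X) ->
        exists X, (X = set0 \/ F X) /\ forall Y, Y \in s -> Y `<=` X.
      elim: s => [_|Y s IH sF]; first by exists set0; split; [left|].
      have [|X [FX sX]] := IH.
        by move=> Z Zs; apply: sF; rewrite inE Zs orbT.
      have FY : F Y by apply: sF; rewrite inE eqxx.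
      have [XY|YX] : X `<=` Y \/ Y `<=` X.
        by case: FX => [->|FX]; [left; exact: sub0set|exact: Ftot].
        exists Y; split; first by right.
        move=> Z; rewrite inE => /predU1P[->//|/sX ZX].
        exact: subset_trans XY.
      by exists X; split=> // Z; rewrite inE => /predU1P[->//|/sX].
    have [|X [FX DX]] := chain_ub (finmap.enum_fset D).
      by move=> X /D_F /set_mem.
    have [x nXx] : exists x, ~ X x.
      by case: FX => [->|/FP[_ [x nx] _ _]]; [exists o|exists x].
    by exists x => Y /DX YX /YX.
  - move=> x y z Nx Ny Nz X FX; have [_ _ sN _] := FP _ FX.
    by apply: sN; [exact: Nx|exact: Ny|exact: Nz].
  - by move=> g x Nx X FX; have [_ _ _ iN] := FP _ FX; apply: iN; exact: Nx.
exists (~` U) => // N' subN' N'U; apply: contrapT => neq.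
apply: (Umax (~` N')); last by rewrite /P setCK.
split; first by rewrite -(setCK U); exact: subsetC.
move=> N'cU; apply: neq; rewrite eqEsubset; split=> //.
by rewrite -(setCK N'); exact: subsetC.
Qed.

(** * Subsystems as spaces in their own right *)

Section Subsystem.
Context {G : topologicalGroupType} {M : topologicalType}.
Context {m : M -> M -> M -> M} {act : G -> M -> M} {N : set M}.
Context (subN : invariant_subsystem m act N).

Let N_med x y z : N x -> N y -> N z -> N (m x y z).
Proof. by case: subN => _ _ + _; apply. Qed.

Let N_act g x : N x -> N (act g x).
Proof. by case: subN => _ _ _; apply. Qed.

Definition sub_med (x y z : N) : N :=
  SigSub (mem_set (N_med (set_valP x) (set_valP y) (set_valP z))).

Definition sub_act (g : G) (x : N) : N :=
  SigSub (mem_set (N_act g (set_valP x))).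

Lemma val_continuous : continuous (set_val : N -> M).
Proof. exact: initial_continuous. Qed.

Lemma continuous_into_sub (T : topologicalType) (f : T -> N) :
  continuous (set_val \o f) -> continuous f.
Proof.
move=> cf x U [B [[A oA <-] Ax AU]].
have xA : nbhs x ((set_val \o f) @^-1` A).
  exact: (cf x A (open_nbhs_nbhs (conj oA Ax))).
have : nbhs x (f @^-1` U) by apply: filterS xA => y; exact: AU.
by [].
Qed.

Lemma val_convex (V : set M) :
  median_convex m V -> median_convex sub_med (set_val @^-1` V).
Proof.
move=> cV x y Vx Vy u /(congr1 set_val) /= xyu.
exact: (cV (set_val x) (set_val y)).
Qed.

Lemma sub_sclocc : sclocc m -> sclocc sub_med.
Proof.
move=> [tm [B cB [oB bB]] loc cptM]; have [[mC mI mD] hM _] := tm; split.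
- split.
  + split=> [x y z|x y|x y z u v]; last by apply: val_inj; exact: mD.
      by split; apply: val_inj; case: (mC (val x) (val y) (val z)).
    by apply: val_inj; exact: mI.
  + move=> x y xy; apply/val_inj/hM => A C Ax Cy.
    have [z [Az Cz]] := xy _ _ (val_continuous Ax) (val_continuous Cy).
    by exists (set_val z).
  + apply: continuous_into_sub.
    have valN (h : N * N * N -> N) : continuous h -> continuous (set_val \o h).
      by move=> ch p; apply: continuous_comp; [exact: ch|exact: val_continuous].
    have c11 : continuous (fun p : N * N * N => p.1.1).
      by move=> p; apply: (@continuous_comp _ _ _ fst fst); exact: cvg_fst.
    have c12 : continuous (fun p : N * N * N => p.1.2).
      move=> p; apply: (@continuous_comp _ _ _ fst snd).
        exact: cvg_fst.
      exact: cvg_snd.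
    have c2 : continuous (fun p : N * N * N => p.2) by move=> p; exact: cvg_snd.
    move=> p.
    exact: (med_cvg tm _ (valN _ c11 p) (valN _ c12 p) (valN _ c2 p)).
- exists [set set_val @^-1` U | U in B].
    exact: sub_countable (card_image_le _ _) cB.
  split=> [_ [U BU <-]|x A [_ [[U oU <-] Ux UA]]].
    by apply: open_comp (oB _ BU) => y _; exact: val_continuous.
  have [V [BV Vx] VU] := bB (set_val x) U (open_nbhs_nbhs (conj oU Ux)).
  exists (set_val @^-1` V); first by split=> //; exists V.
  by apply: subset_trans UA => y /VU.
- move=> x A [_ [[U oU <-] Ux UA]].
  have [V [[oV Vx] cV VU]] := loc (set_val x) U (open_nbhs_nbhs (conj oU Ux)).
  exists (set_val @^-1` V); split; [split=> //|exact: val_convex|].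
    by apply: open_comp oV => y _; exact: val_continuous.
  by apply: subset_trans UA => y /VU.
- have [clN _ _ _] := subN.
  have cN : compact N by exact: subclosed_compact cptM _.
  move=> F PF _; have FN : F (set_val @^-1` N).
    by apply: filterS (@filterT _ F _) => x _; exact: (set_valP x).
  have [x [Nx clx]] := cN (set_val @ F) _ FN.
  exists (SigSub (mem_set Nx)); split=> // A C FA.
  move=> [_ [[U oU <-] Ux UC]].
  have FA' : F (set_val @^-1` (set_val @` A)).
    by apply: filterS FA => y Ay; exists y.
  have [_ [[y Ay <-] Uy]] :=
    clx (set_val @` A) U FA' (open_nbhs_nbhs (conj oU Ux)).
  by exists y; split=> //; exact: UC.
Qed.

Lemma sub_acts : acts_by_continuous_automorphisms m act ->
  acts_by_continuous_automorphisms sub_med sub_act.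
Proof.
move=> [a1 aM aut ac].
have s1 x : sub_act 1%g x = x by apply: val_inj; exact: a1.
have sM g h x : sub_act (g * h)%g x = sub_act g (sub_act h x).
  by apply: val_inj; exact: aM.
split=> // [g|x].
  split; first split.
  - exists (sub_act g^-1%g) => x; first by rewrite -sM mulVg s1.
    by rewrite -sM mulgV s1.
  - by move=> x y z; apply: val_inj; have [[_ +] _] := aut g; apply.
  - apply: continuous_into_sub => x.
    apply: (@continuous_comp _ _ _ set_val (act g)).
      exact: val_continuous.
    by have [_] := aut g; apply.
by apply: continuous_into_sub => g; exact: ac.
Qed.

Lemma sub_minimal :
  (forall N', invariant_subsystem m act N' -> N' `<=` N -> N' = N) ->
  minimal_system sub_med sub_act.
Proof.
move=> minN K [clK [k Kk] subK invK].
have KN : set_val @` K = N.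
  apply: minN; last by move=> _ [x _ <-]; exact: set_valP.
  split.
  - have [A oA AK] := closed_openC clK.
    have -> : set_val @` K = N `&` ~` A.
      rewrite eqEsubset; split=> [_ [x Kx <-]|x [Nx nAx]].
        split; first exact: set_valP.
        by move=> Ax; have : (~` K) x by rewrite -AK.
      exists (SigSub (mem_set Nx)) => //; apply: contrapT => nK.
      apply: nAx.
      by have : (set_val @^-1` A) (SigSub (mem_set Nx)) by rewrite AK.
    by apply: closedI; [case: subN|exact: open_closedC].
  - by exists (set_val k), k.
  - move=> _ _ _ [x Kx <-] [y Ky <-] [z Kz <-].
    by exists (sub_med x y z) => //; exact: subK.
  - by move=> g _ [x Kx <-]; exists (sub_act g x) => //; exact: invK.
rewrite -subTset => x _.
have [y Ky /val_inj <- //] : (set_val @` K) (set_val x).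
by rewrite [X in X _]KN; exact: set_valP.
Qed.

Lemma sub_cube : is_cube sub_med [set: N] -> is_cube m N.
Proof.
move=> [I [f [cI injf cf morf rf]]]; exists I, (set_val \o f); split=> //.
- by move=> a b /val_inj /injf.
- by move=> a; apply: continuous_comp; [exact: cf|exact: val_continuous].
- by move=> a b c; rewrite /= morf.
- rewrite eqEsubset; split=> [x Nx|_ [a _ <-]]; last exact: set_valP.
  have : [set: N] (SigSub (mem_set Nx)) by [].
  by rewrite rf => -[a _ fa]; exists a => //=; rewrite fa.
Qed.

End Subsystem.

(** Left translation of the mean corresponds to moving the argument of [f] by
    the action. *)
Lemma orbit_state (R : realType) (G : topologicalGroupType)
    (M : topologicalType) (m : M -> M -> M -> M) (act : G -> M -> M)
    (mu : (G -> R) -> R) (o : M) :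
  compact [set: M] -> acts_by_continuous_automorphisms m act ->
  left_invariant_mean mu ->
  invariant_state act (fun f : M -> R => mu (fun g => f (act g o))).
Proof.
move=> cptM [a1 aM aut ac] [lin pos one inv].
have Cb (f : M -> R) :
    continuous f -> bounded_continuous R G (fun g => f (act g o)).
  move=> cf; split.
    by move=> g; apply: continuous_comp; [exact: ac|exact: cf].
  have : compact (f @` setT).
    apply: continuous_compact cptM.
    by apply: continuous_subspaceT => x; exact: cf.
  move=> /compact_bounded[k [kR fk]]; exists k; split=> // c kc g _ /=.
  by apply: (fk c kc); exists (act g o).
split=> // [a f g cf cg|f cf f0|h f cf].
- by apply: lin; exact: Cb.
- by apply: pos => //; exact: Cb.
- rewrite -[RHS](inv h^-1%g); last exact: Cb.
  by congr mu; apply/funext => g; rewrite invgK aM.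
Qed.

(** * Invariant cubes *)

Theorem corollary1p2 (R : realType) (G : topologicalGroupType)
    (M : topologicalType) (m : M -> M -> M -> M) (act : G -> M -> M) :
  locally_compact_group G -> amenable R G ->
  sclocc m -> [set: M] !=set0 ->
  acts_by_continuous_automorphisms m act ->
  exists Q : set M, is_cube m Q /\ forall g : G, act g @` Q = Q.
Proof.
move=> _ [mu mean] sM [x0 _] acts; have [_ _ _ cptM] := sM.
have [N subN minN] := @minimal_subsystem_exists G M m act x0 cptM.
have [clN [n Nn] _ invN] := subN.
pose n' : N := SigSub (mem_set Nn).
have sN := sub_sclocc subN sM; have actsN := sub_acts subN acts.
have [_ _ _ cptN] := sN.
exists N; split.
  apply: (sub_cube (subN := subN)).
  have state := orbit_state n' cptN actsN mean.
  exact: (minimal_system_cube n' sN actsN state (sub_minimal minN)).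
move=> g; have [a1 aM _ _] := acts.
rewrite eqEsubset; split=> [_ [x Nx <-]|x Nx]; first exact: invN.
by exists (act g^-1%g x); [exact: invN|rewrite -aM mulgV a1].
Qed.
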